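(* Let $y_h^\star\in\mathbb{R}^{n_h}$ satisfy $F_h(y_h^\star)=0$, let $y_\theta,y_h^\pi\in\mathbb{R}^{n_h}$, and for each $y\in\{y_\theta,y_h^\pi\}$ assume that $J_h(y)$ has full column rank, that $\|y-y_h^\star\|_{X_h}\le t_h^{\mathrm{root}}(y)$, and that a bound $\mathcal R_h^{\mathrm{root}}(y;t_h^{\mathrm{root}}(y))\ge\|R_h^{\mathrm{root}}(y;y-y_h^\star)\|_{W_h}$ is available. Put $\tau_h^\pi:=F_h(y_h^\pi)$, $r_h:=F_h(y_\theta)$, and assume $\varepsilon_{i,h}^{\mathrm{eval}}\ge|L_{i,h}(y_h^\pi)-u^\star(x_i)|$. Define $$\mu_{i,h}^{\mathrm{root,disc}}:=\left|\bigl(g_{i,h}^{\mathrm{root}}(y_h^\pi)\bigr)^\top\tau_h^\pi\right|+\sigma_{i,h}^{\mathrm{root}}(y_h^\pi)\,\mathcal R_h^{\mathrm{root}}(y_h^\pi;t_h^{\mathrm{root}}(y_h^\pi))+\varepsilon_{i,h}^{\mathrm{eval}},$$ $$c_{i,h}^{\mathrm{root,corr}}:=L_{i,h}(y_\theta)-\bigl(g_{i,h}^{\mathrm{root}}(y_\theta)\bigr)^\top r_h .$$ Then $$|c_{i,h}^{\mathrm{root,corr}}-u^\star(x_i)|\le\rho_{i,h}^{\mathrm{root}}:=\sigma_{i,h}^{\mathrm{root}}(y_\theta)\,\mathcal R_h^{\mathrm{root}}(y_\theta;t_h^{\mathrm{root}}(y_\theta))+\mu_{i,h}^{\mathrm{root,disc}}.$$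 Hence $u^\star(x_i)\in[c_{i,h}^{\mathrm{root,corr}}-\rho_{i,h}^{\mathrm{root}},\,c_{i,h}^{\mathrm{root,corr}}+\rho_{i,h}^{\mathrm{root}}]$. Moreover, $$|L_{i,h}(y_\theta)-u^\star(x_i)|\le\sigma_{i,h}^{\mathrm{root}}(y_\theta)\Bigl(\|r_h\|_{W_h}+\mathcal R_h^{\mathrm{root}}(y_\theta;t_h^{\mathrm{root}}(y_\theta))\Bigr)+\mu_{i,h}^{\mathrm{root,disc}},$$ and therefore $$|u_\theta(x_i)-u^\star(x_i)|\le\zeta_{i,h}^\theta+\sigma_{i,h}^{\mathrm{root}}(y_\theta)\Bigl(\|r_h\|_{W_h}+\mathcal R_h^{\mathrm{root}}(y_\theta;t_h^{\mathrm{root}}(y_\theta))\Bigr)+\mu_{i,h}^{\mathrm{root,disc}},$$ where $u_\theta(x_i)\in\mathbb{R}$ is an unprojected neural output and $\zeta_{i,h}^\theta:=|u_\theta(x_i)-L_{i,h}(y_\theta)|$.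
   Context: $u^\star$ is the exact solution (unique in its admissible class) of a boundary-value problem on a bounded domain $\Omega\subset\mathbb{R}^d$, with $u^\star(x_i)$ well defined at the query point $x_i\in\overline\Omega$. $\|\cdot\|_{X_h}$ is a fixed norm on $\mathbb{R}^{n_h}$; $W_h\in\mathbb{R}^{M_h\times M_h}$ is symmetric positive definite with $\|r\|_{W_h}:=(r^\top W_hr)^{1/2}$, $\|g\|_{W_h^{-1}}:=(g^\top W_h^{-1}g)^{1/2}$. $F_h:\mathbb{R}^{n_h}\to\mathbb{R}^{M_h}$ is continuously differentiable on a neighborhood of the relevant points, and $J_h(y):=DF_h(y)$. Full vectors are $U(y):=U_{0,h}+Z_hy$ with $U_{0,h}\in\mathbb{R}^{N_h}$ and $Z_h\in\mathbb{R}^{N_h\times n_h}$ of full column rank; for the query vector $\ell_{i,h}\in\mathbb{R}^{N_h}$, $L_{i,h}(y):=\ell_{i,h}^\top U(y)$ and $\widehat\ell_{i,h}:=Z_h^\top\ell_{i,h}$. When $J_h(y)$ has full column rank, $H_h^{\mathrm{root}}(y):=J_h(y)^\top W_hJ_h(y)$, $q_{i,h}^{\mathrm{root}}(y)$ solves $H_h^{\mathrm{root}}(y)q_{i,h}^{\mathrm{root}}(y)=\widehat\ell_{i,h}$, $g_{i,h}^{\mathrm{root}}(y):=W_hJ_h(y)q_{i,h}^{\mathrm{root}}(y)$, $\sigma_{i,h}^{\mathrm{root}}(y):=\|g_{i,h}^{\mathrm{root}}(y)\|_{W_h^{-1}}$. For $d\in\mathbb{R}^{n_h}$, $R_h^{\mathrm{root}}(y;d):=F_h(y-d)-F_h(y)+J_h(y)d$.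 The quantities $t_h^{\mathrm{root}}(y)$ and $\mathcal R_h^{\mathrm{root}}(y;t_h^{\mathrm{root}}(y))$ are given nonnegative real numbers. *)

(* Defs.v *)
From HB Require Import structures.
From mathcomp Require Import all_boot all_order all_algebra.
From mathcomp Require Import all_classical all_reals all_analysis.

Set Implicit Arguments.
Unset Strict Implicit.
Unset Printing Implicit Defensive.

Import Order.TTheory GRing.Theory Num.Theory.
Import numFieldNormedType.Exports.
Local Open Scope classical_set_scope.
Local Open Scope ring_scope.

(* Only the solution concept matters: the interior equation and the boundary
   condition are kept as arbitrary predicates on candidate functions, of which
   only the values on the closure of the domain are meaningful. *)
Record boundary_problem (R : realType) (d : nat) := BoundaryProblem {
  bp_domain : set 'cV[R]_d ;
  bp_admissible : set ('cV[R]_d -> R) ;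
  bp_equation : set ('cV[R]_d -> R) ;
  bp_boundary : set ('cV[R]_d -> R) }.

Definition is_bounded_domain (R : realType) (d : nat) (Om : set 'cV[R]_d) :=
  [/\ open Om, connected Om & bounded_set Om].

Definition bp_solution (R : realType) (d : nat) (P : boundary_problem R d)
    (u : 'cV[R]_d -> R) : Prop :=
  [/\ bp_admissible P u, bp_equation P u & bp_boundary P u].

Definition bp_unique_solution (R : realType) (d : nat)
    (P : boundary_problem R d) (u : 'cV[R]_d -> R) : Prop :=
  bp_solution P u /\
  forall v, bp_solution P v -> {in closure (bp_domain P), v =1 u}.

Definition is_norm (R : realType) (n : nat) (N : 'cV[R]_n -> R) : Prop :=
  [/\ forall v, 0 <= N v,
      forall v, N v = 0 -> v = 0,
      forall (a : R) v, N (a *: v) = `|a| * N v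
    & forall v w, N (v + w) <= N v + N w].

Definition dotv (R : realType) (n : nat) (v w : 'cV[R]_n) : R :=
  (v^T *m w) 0 0.

Definition is_spd (R : realType) (n : nat) (W : 'M[R]_n) : Prop :=
  W^T = W /\ forall v : 'cV[R]_n, v != 0 -> 0 < dotv v (W *m v).

Definition wnorm (R : realType) (n : nat) (W : 'M[R]_n) (r : 'cV[R]_n) : R :=
  Num.sqrt (dotv r (W *m r)).

Definition full_col_rank (R : realType) (m n : nat) (A : 'M[R]_(m, n)) : Prop :=
  \rank A = n.

(* The library's [jacobian] is for maps between row vectors; this is the usual
   M x n Jacobian matrix of a map between column vectors. *)
Definition jac (R : realType) (n M : nat) (F : 'cV[R]_n -> 'cV[R]_M)
    (y : 'cV[R]_n) : 'M[R]_(M, n) :=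
  \matrix_(i, j) ('d F y (delta_mx j 0 : 'cV[R]_n) : 'cV[R]_M) i 0.

(* Intended for an open set D. *)
Definition C1_on (R : realType) (n M : nat) (D : set 'cV[R]_n)
    (F : 'cV[R]_n -> 'cV[R]_M) : Prop :=
  (forall z, D z -> differentiable F z) /\ {within D, continuous (jac F)}.

Definition full_vec (R : realType) (n N : nat) (U0 : 'cV[R]_N)
    (Z : 'M[R]_(N, n)) (y : 'cV[R]_n) : 'cV[R]_N :=
  U0 + Z *m y.

Definition query (R : realType) (n N : nat) (U0 : 'cV[R]_N)
    (Z : 'M[R]_(N, n)) (ell : 'cV[R]_N) (y : 'cV[R]_n) : R :=
  dotv ell (full_vec U0 Z y).

Definition reduced_query (R : realType) (n N : nat) (Z : 'M[R]_(N, n))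
    (ell : 'cV[R]_N) : 'cV[R]_n :=
  Z^T *m ell.

Definition H_root (R : realType) (n M : nat) (F : 'cV[R]_n -> 'cV[R]_M)
    (W : 'M[R]_M) (y : 'cV[R]_n) : 'M[R]_n :=
  (jac F y)^T *m W *m jac F y.

(* A solution q of H_root F W y *m q = lh; existence and uniqueness follow from
   the full column rank of jac F y (default value 0 if there is none). *)
Definition q_root (R : realType) (n M : nat) (F : 'cV[R]_n -> 'cV[R]_M)
    (W : 'M[R]_M) (lh : 'cV[R]_n) (y : 'cV[R]_n) : 'cV[R]_n :=
  xget 0 [set q : 'cV[R]_n | H_root F W y *m q = lh].

Definition g_root (R : realType) (n M : nat) (F : 'cV[R]_n -> 'cV[R]_M)
    (W : 'M[R]_M) (lh : 'cV[R]_n) (y : 'cV[R]_n) : 'cV[R]_M :=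
  W *m jac F y *m q_root F W lh y.

Definition sigma_root (R : realType) (n M : nat) (F : 'cV[R]_n -> 'cV[R]_M)
    (W : 'M[R]_M) (lh : 'cV[R]_n) (y : 'cV[R]_n) : R :=
  wnorm (invmx W) (g_root F W lh y).

Definition rem_root (R : realType) (n M : nat) (F : 'cV[R]_n -> 'cV[R]_M)
    (y d : 'cV[R]_n) : 'cV[R]_M :=
  F (y - d) - F y + jac F y *m d.

(* Main.v *)
Require Import Defs.
From HB Require Import structures.
From mathcomp Require Import all_boot all_order all_algebra.
From mathcomp Require Import ring lra.
From mathcomp Require Import all_classical all_reals all_analysis.

Set Implicit Arguments.
Unset Strict Implicit.
Unset Printing Implicit Defensive.

Import Order.TTheory GRing.Theory Num.Theory.
Import numFieldNormedType.Exports.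
Local Open Scope classical_set_scope.
Local Open Scope ring_scope.

(* The idea: [g := W J q] with [J^T W J q = Z^T ell] satisfies
   [g^T J = (Z^T ell)^T], so that testing the remainder identity
   [F y = J (y - ystar) - R(y; y - ystar)] against [g] gives exactly
   [L y - g^T (F y) - L ystar = g^T R(y; y - ystar)].  By Cauchy-Schwarz in the
   dual pair of norms of [W] and [W^-1] the right-hand side is at most
   [sigma * |R|_W].  Use this at [ytheta] and [ypi], and chain
   [L ytheta], [L ystar], [L ypi], [ustar xi] with the triangle inequality. *)

Lemma dotvDl (R : realType) (n : nat) (u v w : 'cV[R]_n) :
  dotv (u + v) w = dotv u w + dotv v w.
Proof. by rewrite /dotv raddfD /= mulmxDl mxE. Qed.

Lemma dotvDr (R : realType) (n : nat) (u v w : 'cV[R]_n) :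
  dotv w (u + v) = dotv w u + dotv w v.
Proof. by rewrite /dotv mulmxDr mxE. Qed.

Lemma dotvZl (R : realType) (n : nat) (a : R) (v w : 'cV[R]_n) :
  dotv (a *: v) w = a * dotv v w.
Proof. by rewrite /dotv linearZ /= -scalemxAl mxE. Qed.

Lemma dotvZr (R : realType) (n : nat) (a : R) (v w : 'cV[R]_n) :
  dotv v (a *: w) = a * dotv v w.
Proof. by rewrite /dotv -scalemxAr mxE. Qed.

Lemma dotvC (R : realType) (n : nat) (v w : 'cV[R]_n) : dotv v w = dotv w v.
Proof. by rewrite /dotv -[in RHS](trmxK v) -trmx_mul [RHS]mxE. Qed.

Lemma dotv_mulmxr (R : realType) (m n : nat) (A : 'M[R]_(m, n))
    (v : 'cV[R]_m) (w : 'cV[R]_n) :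
  dotv v (A *m w) = dotv (A^T *m v) w.
Proof. by rewrite /dotv trmx_mul trmxK mulmxA. Qed.

(** A trivial kernel on columns is row-freeness of [A^T], which for a square matrix is
    invertibility. *)
Lemma unitmx_inj (R : realType) (n : nat) (A : 'M[R]_n) :
  (forall v : 'cV[R]_n, A *m v = 0 -> v = 0) -> A \in unitmx.
Proof.
move=> A_inj; rewrite -unitmx_tr -row_free_unit.
apply: inj_row_free => v vA0; apply: trmx_inj; rewrite trmx0.
by apply: A_inj; rewrite -[A]trmxK -trmx_mul vA0 trmx0.
Qed.

Lemma full_col_rank_inj (R : realType) (m n : nat) (A : 'M[R]_(m, n))
    (v : 'cV[R]_n) :
  full_col_rank A -> A *m v = 0 -> v = 0.
Proof.
move=> rA Av0; have fA : row_free A^T by rewrite /row_free mxrank_tr rA.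
apply: trmx_inj; apply: (row_free_inj fA).
by rewrite -trmx_mul Av0 !trmx0 mul0mx.
Qed.

Section SPD.
Variables (R : realType) (n : nat) (W : 'M[R]_n).
Hypothesis W_spd : is_spd W.

Lemma spd_ge0 (v : 'cV[R]_n) : 0 <= dotv v (W *m v).
Proof.
have [->|/W_spd.2/ltW//] := eqVneq v 0.
by rewrite mulmx0 /dotv mulmx0 mxE.
Qed.

Lemma spd_eq0 (v : 'cV[R]_n) : dotv v (W *m v) = 0 -> v = 0.
Proof. by move=> v0; apply/eqP; apply: contraT => /W_spd.2; rewrite v0 ltxx. Qed.

Lemma spd_unitmx : W \in unitmx.
Proof.
apply: unitmx_inj => v Wv0; apply: spd_eq0.
by rewrite Wv0 /dotv mulmx0 mxE.
Qed.

Lemma spd_form_sym (v w : 'cV[R]_n) : dotv v (W *m w) = dotv w (W *m v).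
Proof. by rewrite dotv_mulmxr W_spd.1 dotvC. Qed.

Lemma spd_cauchy_schwarz (v w : 'cV[R]_n) :
  `|dotv v (W *m w)| <= wnorm W v * wnorm W w.
Proof.
rewrite /wnorm -sqrtrM ?spd_ge0// -sqrtr_sqr ler_wsqrtr//.
have [->|w0] := eqVneq w 0.
  by rewrite mulmx0 /dotv !mulmx0 mxE mulr0 expr0n.
have ww_gt0 := W_spd.2 _ w0.
(* [s *: w] is the [W]-orthogonal projection of [v] on [w]; the inequality comes from nonnegativity
   of the form at the residual [v - s *: w]. *)
set s := dotv v (W *m w) / dotv w (W *m w).
have := spd_ge0 (v + (- s) *: w).
rewrite mulmxDr -scalemxAr !(dotvDl, dotvDr, dotvZl, dotvZr).
rewrite (spd_form_sym w v).
have -> : dotv v (W *m w) = s * dotv w (W *m w).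
  by rewrite divfK ?gt_eqF.
(* With [a] and [b] the squared norms of [v] and [w], what is left is that [0 <= a - s^2 b] gives
   [(s b)^2 <= a b], on multiplying by [b > 0]. *)
move: (dotv w _) (dotv v _) ww_gt0 => b a b_gt0.
nra.
Qed.

(** Put [h = W^-1 g]: then [g^T r = h^T W r], and the [W]-norm of [h] is the [W^-1]-norm of [g], so
    this is Cauchy-Schwarz for [h] and [r]. *)
Lemma spd_dual_cauchy_schwarz (g r : 'cV[R]_n) :
  `|dotv g r| <= wnorm (invmx W) g * wnorm W r.
Proof.
have -> : wnorm (invmx W) g = wnorm W (invmx W *m g).
  by rewrite /wnorm mulKVmx ?spd_unitmx// dotvC.
have -> : dotv g r = dotv (invmx W *m g) (W *m r).
  by rewrite spd_form_sym mulKVmx ?spd_unitmx// dotvC.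
exact: spd_cauchy_schwarz.
Qed.

End SPD.

Section RootIdentity.
Variables (R : realType) (n M : nat) (F : 'cV[R]_n -> 'cV[R]_M) (W : 'M[R]_M).
Hypothesis W_spd : is_spd W.
Variable y : 'cV[R]_n.
Hypothesis rank_jac : full_col_rank (jac F y).

(** Since [v^T H v] is the squared [W]-norm of [J v], [H v = 0] forces [J v = 0], hence [v = 0] by
    full column rank. *)
Lemma H_root_unitmx : H_root F W y \in unitmx.
Proof.
apply: unitmx_inj => v Hv0; apply: (full_col_rank_inj rank_jac).
apply: (spd_eq0 W_spd).
have -> : dotv (jac F y *m v) (W *m (jac F y *m v)) = dotv v (H_root F W y *m v).
  by rewrite /dotv /H_root trmx_mul !mulmxA.
by rewrite Hv0 /dotv mulmx0 mxE.
Qed.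

(** Invertibility of [H_root] supplies a solution, so [xget] does not fall back on its default 0. *)
Lemma q_rootP (lh : 'cV[R]_n) : H_root F W y *m q_root F W lh y = lh.
Proof.
apply: (xgetPex 0 (P := [set q | H_root F W y *m q = lh])).
by exists (invmx (H_root F W y) *m lh); rewrite /= mulKVmx ?H_root_unitmx.
Qed.

(** The adjoint equation: [J^T g = J^T W J q = H q = lh]. *)
Lemma dotv_g_root_jac (lh v : 'cV[R]_n) :
  dotv (g_root F W lh y) (jac F y *m v) = dotv lh v.
Proof.
by rewrite dotv_mulmxr -[in RHS](q_rootP lh) /g_root /H_root !mulmxA.
Qed.

Variables (N : nat) (U0 : 'cV[R]_N) (Z : 'M[R]_(N, n)) (ell : 'cV[R]_N).

Lemma query_root_identity (ystar : 'cV[R]_n) : F ystar = 0 ->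
  query U0 Z ell y - dotv (g_root F W (reduced_query Z ell) y) (F y)
    - query U0 Z ell ystar
  = dotv (g_root F W (reduced_query Z ell) y) (rem_root F y (y - ystar)).
Proof.
(* As [y - (y - ystar) = ystar] is a root, the remainder is [J (y - ystar) - F y]. The offset [U0]
   then cancels between the two queries. *)
move=> Fystar0; rewrite /rem_root subKr Fystar0 sub0r dotvDr dotv_g_root_jac.
rewrite -[- F y]scaleN1r dotvZr -dotv_mulmxr mulmxBr.
rewrite /query /full_vec -[- (Z *m ystar)]scaleN1r !dotvDr dotvZr.
ring.
Qed.

Lemma query_root_bound (ystar : 'cV[R]_n) (rho : R) : F ystar = 0 ->
  wnorm W (rem_root F y (y - ystar)) <= rho ->
  `|query U0 Z ell y - dotv (g_root F W (reduced_query Z ell) y) (F y)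
      - query U0 Z ell ystar|
  <= sigma_root F W (reduced_query Z ell) y * rho.
Proof.
move=> Fystar0 rem_le; rewrite query_root_identity//.
apply: le_trans (spd_dual_cauchy_schwarz W_spd _ _) _.
by rewrite ler_wpM2l ?sqrtr_ge0.
Qed.

End RootIdentity.

Theorem theorem6p3 (R : realType) (d n M N : nat)
  (BVP : boundary_problem R d) (ustar : 'cV[R]_d -> R) (xi : 'cV[R]_d)
  (normX : 'cV[R]_n -> R) (W : 'M[R]_M)
  (F : 'cV[R]_n -> 'cV[R]_M) (D : set 'cV[R]_n)
  (U0 : 'cV[R]_N) (Z : 'M[R]_(N, n)) (ell : 'cV[R]_N)
  (t : 'cV[R]_n -> R) (calR : 'cV[R]_n -> R -> R)
  (ystar ytheta ypi : 'cV[R]_n) (eps_eval : R) (utheta : 'cV[R]_d -> R) :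
  is_bounded_domain (bp_domain BVP) ->
  bp_unique_solution BVP ustar ->
  closure (bp_domain BVP) xi ->
  is_norm normX ->
  is_spd W ->
  open D -> D ystar -> D ytheta -> D ypi -> C1_on D F ->
  full_col_rank Z ->
  F ystar = 0 ->
  (forall y, y \in [:: ytheta; ypi] ->
     [/\ full_col_rank (jac F y),
         0 <= t y,
         normX (y - ystar) <= t y,
         0 <= calR y (t y)
       & wnorm W (rem_root F y (y - ystar)) <= calR y (t y)]) ->
  let L := query U0 Z ell in
  let g := g_root F W (reduced_query Z ell) in
  let sigma := sigma_root F W (reduced_query Z ell) in
  let tau := F ypi in
  let r := F ytheta in
  `|L ypi - ustar xi| <= eps_eval ->
  let mu_disc := `|dotv (g ypi) tau| + sigma ypi * calR ypi (t ypi)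
                 + eps_eval in
  let c_corr := L ytheta - dotv (g ytheta) r in
  let rho := sigma ytheta * calR ytheta (t ytheta) + mu_disc in
  let zeta := `|utheta xi - L ytheta| in
  [/\ `|c_corr - ustar xi| <= rho,
      ustar xi \in `[c_corr - rho, c_corr + rho],
      `|L ytheta - ustar xi|
        <= sigma ytheta * (wnorm W r + calR ytheta (t ytheta)) + mu_disc
    & `|utheta xi - ustar xi|
        <= zeta + sigma ytheta * (wnorm W r + calR ytheta (t ytheta))
           + mu_disc].
Proof.
move=> _ _ _ _ W_spd _ _ _ _ _ _ Fystar0 Hy L g sigma tau r eval_le
  mu_disc c_corr rho zeta.
have bound y : y \in [:: ytheta; ypi] ->
    `|L y - dotv (g y) (F y) - L ystar| <= sigma y * calR y (t y).
  by move=> /Hy[rank_jac _ _ _ rem_le]; apply: query_root_bound.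
have disc_le : `|L ystar - ustar xi| <= mu_disc.
  have := bound ypi; rewrite !inE eqxx orbT => /(_ isT) bpi.
  (* [ypi] is the bridge from the discrete root to the exact solution: the three terms of [mu_disc]
     bound the evaluation error, the residual [tau] tested against [g], and the remainder at
     [ypi]. *)
  have -> : L ystar - ustar xi = (L ypi - ustar xi)
      - (dotv (g ypi) tau + (L ypi - dotv (g ypi) tau - L ystar)) by ring.
  apply: le_trans (ler_normB _ _) _; rewrite addrC lerD//.
  by apply: le_trans (ler_normD _ _) _; rewrite lerD2l.
have corr_le : `|c_corr - ustar xi| <= rho.
  (* Through [L ystar]: the remainder bound at [ytheta] plus the discretization error [mu_disc]. *)
  rewrite -(subrKA (L ystar)); apply: le_trans (ler_normD _ _) _.
  by rewrite lerD// bound ?mem_head.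
have query_le : `|L ytheta - ustar xi|
    <= sigma ytheta * (wnorm W r + calR ytheta (t ytheta)) + mu_disc.
  (* Without the correction, the dropped term [g^T r] costs at most [sigma] times the [W]-norm of
     [r]. *)
  have -> : L ytheta - ustar xi = dotv (g ytheta) r + (c_corr - ustar xi).
    by rewrite /c_corr; ring.
  apply: le_trans (ler_normD _ _) _; rewrite mulrDr -[leRHS]addrA lerD//.
  exact: (spd_dual_cauchy_schwarz W_spd).
split=> //.
  by move: corr_le; rewrite distrC ler_distl in_itv.
rewrite -(subrKA (L ytheta)); apply: le_trans (ler_normD _ _) _.
by rewrite -[leRHS]addrA lerD2l.
Qed.
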